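(* No divisor in $|\mathcal{O}_X(1,1,1,1)|$ is invariant under the action of the group $\langle(\mathrm{Id},\mathrm{Id},\mathrm{Id},A)\circ(1324),\ (B,B,B,B)\rangle\simeq\mathbb{Z}_8\oplus\mathbb{Z}_2$, nor under the action of the group $\langle(\mathrm{Id},A,\mathrm{Id},A)\circ(12)(34),\ (\mathrm{Id},\mathrm{Id},B,B)\circ(13)(24)\rangle\simeq\mathbb{Z}_4\oplus\mathbb{Z}_4$.
   Context: $X=\mathbb{P}^1\times\mathbb{P}^1\times\mathbb{P}^1\times\mathbb{P}^1$ over $\mathbb{C}$. For $A_i\in\operatorname{PGL}(2)$ and $\sigma\in S_4$, $(A_1,A_2,A_3,A_4)\circ\sigma$ denotes the automorphism $(x_1,x_2,x_3,x_4)\mapsto(A_1x_{\sigma(1)},A_2x_{\sigma(2)},A_3x_{\sigma(3)},A_4x_{\sigma(4)})$ of $X$. $A\colon(x_0:x_1)\mapsto(x_0:-x_1)$ and $B\colon(x_0:x_1)\mapsto(x_1:x_0)$ are automorphisms of $\mathbb{P}^1$. *)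

(* Defs.v *)
From HB Require Import structures.
From mathcomp Require Import all_boot all_order all_algebra all_fingroup.
From mathcomp Require Import classical_sets.

Set Implicit Arguments.
Unset Strict Implicit.
Unset Printing Implicit Defensive.

Import GRing.Theory.
Local Open Scope ring_scope.

(* Projective space of a finite-dimensional vector space, as its set of
   lines through 0. *)
Definition proj (K : fieldType) (V : vectType K) : Type :=
  {U : {vspace V} | \dim U == 1%N}.

Definition P1 (K : fieldType) : Type := proj 'cV[K]_2.

Definition GL2 (K : fieldType) : Type := {M : 'M[K]_2 | M \in unitmx}.

Lemma mobius_dim (K : fieldType) (M : GL2 K) (p : P1 K) :
  \dim (linfun (mulmx (val M)) @: val p)%VS == 1%N.
Proof.
case: M p => [M Mu] [U dU] /=; rewrite limg_dim_eq //.
suff -> : lker (linfun (mulmx M) : 'Hom('cV[K]_2, 'cV[K]_2)) = 0%VS.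
  by rewrite capv0.
apply/eqP/lker0P => u v; rewrite !lfunE /= => e.
by rewrite -(mulKmx Mu u) e mulKmx.
Qed.

(* The automorphism of P^1 induced by an invertible matrix, that is, the
   element of PGL(2) it represents. *)
Definition mobius (K : fieldType) (M : GL2 K) (p : P1 K) : P1 K :=
  exist (fun U => \dim U == 1%N) _ (mobius_dim M p).

Definition mx2 (K : fieldType) (a b c d : K) : 'M[K]_2 :=
  \matrix_(i, j) (if i == 0 then (if j == 0 then a else b)
                  else (if j == 0 then c else d)).

Lemma mxA_unit (K : fieldType) : mx2 1 0 0 (-1 : K) \in unitmx.
Proof.
apply: (proj1 (@mulmx1_unit _ _ _ (mx2 1 0 0 (-1 : K)) _)).
apply/matrixP => i j; rewrite !mxE big_ord_recl big_ord1 !mxE /=.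
by case: i j => [[|[|//]] ?] [[|[|//]] ?] /=;
   rewrite ?mulr0 ?mul0r ?mulr1 ?mulrNN ?mulr1 ?mulN1r ?oppr0 ?addr0 ?add0r.
Qed.

Lemma mxB_unit (K : fieldType) : mx2 0 1 1 (0 : K) \in unitmx.
Proof.
apply: (proj1 (@mulmx1_unit _ _ _ (mx2 0 1 1 (0 : K)) _)).
apply/matrixP => i j; rewrite !mxE big_ord_recl big_ord1 !mxE /=.
by case: i j => [[|[|//]] ?] [[|[|//]] ?] /=;
   rewrite ?mulr0 ?mul0r ?mulr1 ?addr0 ?add0r.
Qed.

(* A : (x0 : x1) |-> (x0 : - x1)  and  B : (x0 : x1) |-> (x1 : x0). *)
Definition mobA (K : fieldType) : P1 K -> P1 K :=
  mobius (exist (fun M => M \in unitmx) _ (mxA_unit K)).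
Definition mobB (K : fieldType) : P1 K -> P1 K :=
  mobius (exist (fun M => M \in unitmx) _ (mxB_unit K)).

Arguments mobA K : clear implicits.
Arguments mobB K : clear implicits.

Definition i1 : 'I_4 := @Ordinal 4 0 isT.
Definition i2 : 'I_4 := @Ordinal 4 1 isT.
Definition i3 : 'I_4 := @Ordinal 4 2 isT.
Definition i4 : 'I_4 := @Ordinal 4 3 isT.

(* (s * t) i = t (s i) for permutations, so this maps
   a |-> b |-> c |-> d |-> a. *)
Definition cycle4 (a b c d : 'I_4) : 'S_4 :=
  (tperm a b * tperm a c * tperm a d)%g.

Definition X (K : fieldType) : Type := {ffun 'I_4 -> P1 K}.

(* (a_1, a_2, a_3, a_4) \o s : x |-> (a_1 x_{s 1}, ..., a_4 x_{s 4}). *)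
Definition prod_aut (K : fieldType) (a : 'I_4 -> P1 K -> P1 K) (s : 'S_4)
    (x : X K) : X K :=
  [ffun i => a i (x (s i))].

Definition quad (T : Type) (a1 a2 a3 a4 : T) : 'I_4 -> T :=
  tnth [tuple a1; a2; a3; a4].

(* The group generated by a set S of invertible maps, under composition. *)
Inductive gen_group (T : Type) (S : set (T -> T)) : set (T -> T) :=
| gen_id : gen_group S id
| gen_in g : S g -> gen_group S g
| gen_comp g h : gen_group S g -> gen_group S h -> gen_group S (g \o h)
| gen_inv g h : gen_group S g -> cancel g h -> cancel h g -> gen_group S h.

(* The group G of maps, under composition, is isomorphic to V. *)
Definition isomorphic_to (V : zmodType) (T : Type) (G : set (T -> T)) : Prop :=
  exists phi : V -> T -> T,
    [/\ injective phi,
        forall u v, phi (u + v) = phi u \o phi v &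
        forall g, G g <-> exists u, g = phi u].

(* H^0(X, O_X(1,1,1,1)): forms of multidegree (1,1,1,1) in the homogeneous
   coordinates, s e being the coefficient of the monomial
   x_{1, e 1} x_{2, e 2} x_{3, e 3} x_{4, e 4}. *)
Definition H0 (K : fieldType) : vectType K :=
  {ffun {ffun 'I_4 -> 'I_2} -> K^o}.

Definition form_eval (K : fieldType) (s : H0 K) (x : 'I_4 -> 'cV[K]_2) : K :=
  \sum_(e : {ffun 'I_4 -> 'I_2}) s e * \prod_(i < 4) x i (e i) 0.

(* |O_X(1,1,1,1)|: the divisor of zeros of a nonzero form is identified with
   the class of the form up to nonzero scalars. *)
Definition linsys (K : fieldType) : Type := proj (H0 K).

Definition lift_act (K : fieldType) (M : 'I_4 -> GL2 K) (p : 'S_4)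
    (x : 'I_4 -> 'cV[K]_2) : 'I_4 -> 'cV[K]_2 :=
  fun i => val (M i) *m x (p i).

(* The form x |-> s (lift_act M p x), by form_eval_pullback; its coefficients
   are its values at tuples of basis vectors. *)
Definition pullback_fun (K : fieldType) (M : 'I_4 -> GL2 K) (p : 'S_4)
    (s : H0 K) : H0 K :=
  [ffun e : {ffun 'I_4 -> 'I_2} =>
    form_eval s (lift_act M p (fun i => delta_mx (e i) 0))].

Lemma form_eval_pullback (K : fieldType) (M : 'I_4 -> GL2 K) (p : 'S_4)
    (s : H0 K) (x : 'I_4 -> 'cV[K]_2) :
  form_eval (pullback_fun M p s) x = form_eval s (lift_act M p x).
Proof.
have mulE i (v : 'cV[K]_2) a :
    (val (M i) *m v) a 0 = \sum_k val (M i) a k * v k 0 by rewrite mxE.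
rewrite /form_eval /lift_act.
under [RHS]eq_bigr => e _.
  under eq_bigr => i _ do rewrite mulE.
  rewrite bigA_distr_bigA /= big_distrr /=.
  over.
rewrite [RHS]exchange_big /=.
pose h (q : 'S_4) (f : {ffun 'I_4 -> 'I_2}) := [ffun i => f (q i)].
have hK (q q' : 'S_4) : cancel q q' -> cancel (h q') (h q).
  by move=> c f; apply/ffunP => i; rewrite !ffunE c.
rewrite [RHS](reindex (h p)) /=; last first.
  exists (h p^-1%g) => f _; apply: hK => i; [exact: permKV | exact: permK].
apply: eq_bigr => f _; rewrite ffunE /form_eval big_distrl /=.
apply: eq_bigr => e _; rewrite -mulrA; congr (_ * _).
rewrite [X in _ * X](reindex_inj (@perm_inj _ p)) -big_split /=.
apply: eq_bigr => i _; rewrite ffunE mulE; congr (_ * _).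
rewrite (bigD1 (f (p i))) //= big1 ?addr0 ?mxE ?eqxx ?mulr1 // => k kf.
by rewrite !mxE (negPf kf) mulr0.
Qed.

Lemma pullback_is_linear (K : fieldType) (M : 'I_4 -> GL2 K) (p : 'S_4) :
  linear (pullback_fun M p).
Proof.
move=> c s t; apply/ffunP => e; rewrite !ffunE /form_eval.
rewrite scaler_sumr -big_split; apply: eq_bigr => f _ /=.
by rewrite !ffunE mulrDl -mulrA.
Qed.

HB.instance Definition _ (K : fieldType) (M : 'I_4 -> GL2 K) (p : 'S_4) :=
  GRing.isLinear.Build K (H0 K) (H0 K) _ _ (pullback_is_linear M p).

Definition pullback (K : fieldType) (M : 'I_4 -> GL2 K) (p : 'S_4) :
  'End(H0 K) := linfun (pullback_fun M p).

Lemma line_dim (K : fieldType) (v : 'cV[K]_2) :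
  v != 0 -> \dim <[v]>%VS == 1%N.
Proof. by move=> v0; rewrite dim_vline v0. Qed.

Definition pt (K : fieldType) (v : 'cV[K]_2) (v0 : v != 0) : P1 K :=
  exist (fun U => \dim U == 1%N) _ (line_dim v0).

Lemma mobius_pt (K : fieldType) (M : GL2 K) (v : 'cV[K]_2) (v0 : v != 0) :
  val (mobius M (pt v0)) = <[val M *m v]>%VS.
Proof. by rewrite /= limg_line lfunE. Qed.

Lemma mobius_inj (K : fieldType) (M : GL2 K) : injective (mobius M).
Proof.
move=> p q /(congr1 val) /= e; apply/val_inj => /=.
have k0 : lker (linfun (mulmx (val M)) : 'Hom('cV[K]_2, 'cV[K]_2)) == 0%VS.
  apply/lker0P => u v; rewrite !lfunE /= => e'.
  by rewrite -(mulKmx (valP M) u) e' mulKmx // (valP M).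
by apply/eqP; rewrite -(eq_limg_ker0 _ _ k0) e.
Qed.

Lemma mobius_eq (K : fieldType) (M N : GL2 K) :
  mobius M =1 mobius N -> exists2 c, c != 0 & val M = c *: val N.
Proof.
move=> e.
have key (v : 'cV[K]_2) : v != 0 -> exists c, val M *m v = c *: (val N *m v).
  move=> v0; apply/vlineP; rewrite -mobius_pt -e mobius_pt.
  exact: memv_line.
pose d (i : 'I_2) : 'cV[K]_2 := delta_mx i 0.
have d0 i : d i != 0.
  by apply/eqP => /matrixP/(_ i 0); rewrite !mxE !eqxx => /eqP; rewrite oner_eq0.
have [a ha] := key _ (d0 0); have [b hb] := key _ (d0 1).
have s0 : d 0 + d 1 != 0.
  apply/eqP => /matrixP/(_ 0 0); rewrite !mxE !eqxx /= addr0 => /eqP.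
  by rewrite oner_eq0.
have [c hc] := key _ s0.
have : c *: (d 0 + d 1) = a *: d 0 + b *: d 1.
  apply: (can_inj (mulKmx (valP N))).
  by rewrite -scalemxAr -hc !mulmxDr -!scalemxAr -ha -hb.
move/matrixP => h; move: (h 0 0) (h 1 0); rewrite !mxE /=.
rewrite !mulr1 !mulr0 !addr0 !add0r !mulr1 => ca cb; subst a b.
have MN : val M = c *: val N.
  apply/matrixP => i j.
  have hj : val M *m d j = c *: (val N *m d j).
    by case: j => [[|[|//]] lj]; [move: ha|move: hb];
       rewrite /d; congr (_ *m delta_mx _ _ = _ *: (_ *m delta_mx _ _));
       apply/val_inj.
  move/matrixP/(_ i 0): hj; rewrite -!colE !mxE; exact.
exists c => //; apply/eqP => c0; move: (valP M).
by rewrite MN c0 scale0r unitmxE det0 unitr0.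
Qed.

Lemma pullback_lift (K : fieldType) (M N : 'I_4 -> GL2 K) (p q : 'S_4) :
  prod_aut (fun i => mobius (M i)) p = prod_aut (fun i => mobius (N i)) q ->
  exists2 c, c != 0 & forall s, pullback M p s = c *: pullback N q s.
Proof.
move=> e.
have d0 (i : 'I_2) : (delta_mx i 0 : 'cV[K]_2) != 0.
  by apply/eqP => /matrixP/(_ i 0); rewrite !mxE !eqxx => /eqP; rewrite oner_eq0.
have pt01 : pt (d0 0) <> pt (d0 1).
  move=> /(congr1 val) /= h.
  have : (delta_mx 1 0 : 'cV[K]_2)%R \in <[(delta_mx 0 0 : 'cV[K]_2)%R]>%VS.
    by rewrite h memv_line.
  move=> /vlineP [c /matrixP/(_ 1 0)]; rewrite !mxE /= mulr0 => /eqP.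
  by rewrite oner_eq0.
have ei (x : X K) i : mobius (M i) (x (p i)) = mobius (N i) (x (q i)).
  by have /ffunP/(_ i) := congr1 (fun f => f x) e; rewrite !ffunE.
have pq : p = q.
  apply/permP => i; apply/eqP/negP => /negP npq.
  pose x b : X K := [ffun j => if b && (j == p i) then pt (d0 1) else pt (d0 0)].
  apply: pt01; apply: (@mobius_inj _ (M i)).
  have := ei (x true) i; have := ei (x false) i.
  by rewrite !ffunE /= eqxx eq_sym (negPf npq) => -> ->.
subst q.
have /fin_all_exists [c hc] i :
    exists c, c != 0 /\ val (M i) = c *: val (N i).
  suff /mobius_eq[c c0 h] : mobius (M i) =1 mobius (N i) by exists c.
  by move=> y; have := ei [ffun=> y] i; rewrite !ffunE.
exists (\prod_i c i).
  by apply/prodf_neq0 => i _; case: (hc i).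
move=> s; rewrite !lfunE /=; apply/ffunP => f; rewrite !ffunE /form_eval.
rewrite scaler_sumr; apply: eq_bigr => g _.
rewrite -[_ *: _]/(_ * _) mulrCA -big_split /=; congr (_ * _).
apply: eq_bigr => i _; rewrite /lift_act; have [_ ->] := hc i.
by rewrite -scalemxAl !mxE.
Qed.

(* g^* D = D.  The pullback of D is computed on any lift of g to homogeneous
   coordinates; by pullback_lift it does not depend on the lift. *)
Definition preserves (K : fieldType) (g : X K -> X K) (D : linsys K) : Prop :=
  exists M p, g = prod_aut (fun i => mobius (M i)) p /\
    (pullback M p @: val D)%VS = val D.

Definition invariant_div (K : fieldType) (G : set (X K -> X K))
    (D : linsys K) : Prop :=
  forall g, G g -> preserves g D.

(* Main.v *)
Require Import Defs.
From mathcomp Require Import all_boot all_order all_algebra all_fingroup.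
From mathcomp Require Import boolp classical_sets reals.
From mathcomp.real_closed Require Import complex.

(** In each group the two generators commute, but their lifts to homogeneous
    coordinates do not: commuting them exchanges AB with BA in exactly one
    factor, and the matrices satisfy AB = - BA.  Hence the lifts anticommute on
    H^0(O(1,1,1,1)), and a common eigenvector, with nonzero eigenvalues a and b,
    would give ab = - ab.  For the isomorphism types, a diagonal point
    (y,y,y,y), where y has trivial stabilizer in the Klein group <A,B>, has a
    free orbit under both groups. *)

Set Implicit Arguments.
Unset Strict Implicit.
Unset Printing Implicit Defensive.

Import Order.TTheory GRing.Theory Num.Theory.
Local Open Scope ring_scope.

(** * Groups generated by two commuting maps of finite order *)

Lemma iter_modn (T : Type) (f : T -> T) (m k : nat) (x : T) :
  iter m f =1 id -> iter (k %% m) f x = iter k f x.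
Proof.
move=> fm; rewrite [in RHS](divn_eq k m) addnC iterD iterM.
by rewrite (iter_fix _ (fm x)).
Qed.

Lemma iter_comm (T : Type) (f g : T -> T) (i j : nat) (x : T) :
  (forall y, f (g y) = g (f y)) -> iter i f (iter j g x) = iter j g (iter i f x).
Proof.
move=> fg; elim: i => //= i ->; elim: j => //= j IH.
by rewrite fg IH.
Qed.

Lemma gen_group_iter (T : Type) (S : set (T -> T)) (f : T -> T) (n : nat) :
  S f -> gen_group S (iter n f).
Proof.
move=> Sf; elim: n => [|n IH]; first exact: gen_id.
exact: gen_comp (gen_in Sf) IH.
Qed.

(** The isomorphism sends [(i, j)] to the composite of the [i]-th iterate of [f] and the [j]-th
    iterate of [g]. The finite orders make it well defined modulo [m.+2] and [n.+2], commutation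
    makes it a homomorphism, and the free orbit of [x0] gives injectivity. *)
Lemma gen_group_isog_ZxZ (T : Type) (f g : T -> T) (m n : nat) (x0 : T) :
  iter m.+2 f =1 id -> iter n.+2 g =1 id ->
  (forall x, f (g x) = g (f x)) ->
  (forall i j, (i < m.+2)%N -> (j < n.+2)%N ->
     iter i f (iter j g x0) = x0 -> i = 0%N /\ j = 0%N) ->
  isomorphic_to ('Z_m.+2 * 'Z_n.+2)%type (gen_group [set f; g]%classic).
Proof.
move=> fm gn fg free.
pose phi (u : 'Z_m.+2 * 'Z_n.+2) : T -> T := iter u.1 f \o iter u.2 g.
have phiD u v : phi (u + v) = phi u \o phi v.
  apply: funext => x; rewrite /phi /= (iter_modn _ _ fm) (iter_modn _ _ gn).
  by rewrite !iterD -(iter_comm v.1 u.2 _ fg).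
have phi0 : phi 0 = id by [].
have phiI : injective phi.
  move=> u v uv; apply/eqP; rewrite -subr_eq0; apply/eqP.
  (* Injectivity is reduced to a trivial kernel: [phi (u - v)] is the identity, hence fixes [x0]. *)
  have /(congr1 (@^~ x0)) : phi (u - v) = id by rewrite phiD uv -phiD subrr.
  case: (u - v) => a b /(free _ _ (ltn_ord a) (ltn_ord b)) [a0 b0].
  by congr (_, _); apply: val_inj.
exists phi; split => // h; split => [|[u ->]]; last first.
  by apply: gen_comp; apply: gen_group_iter; [left | right].
elim=> [|_ [->|->]|_ _ _ [u ->] _ [v ->]|_ k _ [u ->] uk ku].
- by exists 0.
- by exists (1, 0).
- by exists (0, 1).
- by exists (u + v).
(* A two-sided inverse [k] of [phi u] must be [phi (- u)], which is already a left inverse. *)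
exists (- u); apply: funext => x; rewrite -[in RHS](ku x).
by rewrite -[RHS]/((phi (- u) \o phi u) (k x)) -phiD addNr.
Qed.

Lemma ord4P (P : 'I_4 -> Prop) : P i1 -> P i2 -> P i3 -> P i4 -> forall i, P i.
Proof.
move=> p1 p2 p3 p4.
by case=> [[|[|[|[|//]]]] li]; [move: p1|move: p2|move: p3|move: p4];
  congr P; apply: val_inj.
Qed.

(** * Projective transformations of the line and points of the fourfold product *)

Section Mobius.
Variable K : fieldType.

Lemma mobius_comp_eq (M N P Q : GL2 K) (c : K) :
  c != 0 -> val M *m val N = c *: (val P *m val Q) ->
  forall x, mobius M (mobius N x) = mobius P (mobius Q x).
Proof.
move=> c0 e x; apply: val_inj => /=; rewrite -!limg_comp.
have -> : val x = <[vpick (val x)]>%VS.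
  apply/eqP; rewrite eq_sym eqEdim -memvE memv_pick dim_vline vpick0.
  by rewrite -dimv_eq0 (eqP (valP x)).
rewrite !limg_line !comp_lfunE !lfunE /= !mulmxA e -scalemxAl.
apply/eqP; rewrite eqEsubv -!memvE memvZ ?memv_line //=.
by rewrite -[X in X \in _](scalerK c0) memvZ ?memv_line.
Qed.

Definition gl2_1 : GL2 K := exist (fun M => M \in unitmx) 1%:M (unitmx1 _ _).

Lemma mobius1 : mobius gl2_1 = id.
Proof.
apply: funext => x; apply: val_inj => /=.
rewrite -[RHS]lim1g; congr (_ @: _)%VS; apply/lfunP => v.
by rewrite lfunE id_lfunE /= mul1mx.
Qed.

Definition gl2_A : GL2 K := exist (fun M => M \in unitmx) _ (mxA_unit K).
Definition gl2_B : GL2 K := exist (fun M => M \in unitmx) _ (mxB_unit K).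

Lemma mx2_mul (a b c d a' b' c' d' : K) :
  mx2 a b c d *m mx2 a' b' c' d' =
  mx2 (a * a' + b * c') (a * b' + b * d') (c * a' + d * c') (c * b' + d * d').
Proof.
apply/matrixP => i j; rewrite !mxE big_ord_recl big_ord1 !mxE /=.
by case: i j => [[|[|//]] ?] [[|[|//]] ?].
Qed.

Lemma mx2_eqP (M N : 'M[K]_2) :
  M 0 0 = N 0 0 -> M 0 1 = N 0 1 -> M 1 0 = N 1 0 -> M 1 1 = N 1 1 -> M = N.
Proof.
move=> e1 e2 e3 e4; apply/matrixP.
by case=> [[|[|//]] li] [[|[|//]] lj];
  [move: e1|move: e2|move: e3|move: e4]; congr (M _ _ = N _ _); apply: val_inj.
Qed.

(** This sign vanishes in PGL(2), where the two involutions commute, but survives on multilinear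
    forms. *)
Lemma gl2_AB : val gl2_A *m val gl2_B = - 1 *: (val gl2_B *m val gl2_A).
Proof.
rewrite !mx2_mul; apply: mx2_eqP; rewrite !mxE /=;
  by rewrite ?(mulr0, mul0r, mulr1, mul1r, addr0, add0r, opprK, mulN1r, oppr0).
Qed.

Lemma mobius_invol (M : GL2 K) :
  val M *m val M = 1%:M -> involutive (mobius M).
Proof.
move=> M2 x; transitivity (mobius gl2_1 (mobius gl2_1 x)); last by rewrite !mobius1.
by apply: (mobius_comp_eq (oner_neq0 _)); rewrite mulmx1 scale1r.
Qed.

Lemma mobA_invol : involutive (mobA K).
Proof.
apply: mobius_invol; rewrite mx2_mul; apply: mx2_eqP; rewrite !mxE /=;
  by rewrite ?(mulr0, mul0r, mulr1, addr0, add0r, opprK, mulN1r, oppr0).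
Qed.

Lemma mobB_invol : involutive (mobB K).
Proof.
apply: mobius_invol; rewrite mx2_mul; apply: mx2_eqP; rewrite !mxE /=;
  by rewrite ?(mulr0, mul0r, mulr1, addr0, add0r).
Qed.

Lemma mobAB (x : P1 K) : mobA K (mobB K x) = mobB K (mobA K x).
Proof. by apply: (mobius_comp_eq _ gl2_AB); rewrite oppr_eq0 oner_eq0. Qed.

(** A fixed point is an eigenvector, and then the determinant with columns [M v] and [v]
    vanishes. *)
Lemma mobius_pt_neq (M : GL2 K) (v : 'cV[K]_2) (v0 : v != 0) :
  (val M *m v) 0 0 * v 1 0 != (val M *m v) 1 0 * v 0 0 ->
  mobius M (pt v0) <> pt v0.
Proof.
move=> /eqP ne /(congr1 val); rewrite mobius_pt /= => e; apply: ne.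
have : val M *m v \in <[v]>%VS by rewrite -e memv_line.
by case/vlineP => c ->; rewrite !mxE mulrAC.
Qed.

Lemma prod_autE (a : 'I_4 -> P1 K -> P1 K) (s : 'S_4) (x : X K) (i : 'I_4) :
  prod_aut a s x i = a i (x (s i)).
Proof. by rewrite ffunE. Qed.

Definition qpt (a b c d : P1 K) : X K := [ffun i => quad a b c d i].

Lemma qptP (x y : X K) :
  x i1 = y i1 -> x i2 = y i2 -> x i3 = y i3 -> x i4 = y i4 -> x = y.
Proof. by move=> *; apply/ffunP; apply: ord4P. Qed.

Lemma qpt_eta (x : X K) : x = qpt (x i1) (x i2) (x i3) (x i4).
Proof. by apply: qptP; rewrite ffunE. Qed.

Lemma qpt_inj (a b c d a' b' c' d' : P1 K) :
  qpt a b c d = qpt a' b' c' d' -> [/\ a = a', b = b', c = c' & d = d'].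
Proof.
by move/ffunP => e; split; [move: (e i1)|move: (e i2)|move: (e i3)|move: (e i4)];
  rewrite !ffunE.
Qed.

(** * Action on multilinear forms and invariant lines *)

Lemma form_eval_delta (s : H0 K) (e : {ffun 'I_4 -> 'I_2}) :
  form_eval s (fun i => delta_mx (e i) 0) = s e.
Proof.
rewrite /form_eval (bigD1 e) //= big1 => [|i _]; last by rewrite mxE !eqxx.
rewrite mulr1 big1 ?addr0 // => f fe.
have [i fi] : exists i, f i != e i.
  by apply/existsP; rewrite -negb_forall; apply: contra fe => /eqfunP/ffunP ->.
by rewrite (bigD1 i) //= mxE (negPf fi) mul0r mulr0.
Qed.

Lemma form_eval_scale (s : H0 K) (c : 'I_4 -> K) (x y : 'I_4 -> 'cV[K]_2) :
  (forall i, x i = c i *: y i) ->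
  form_eval s x = (\prod_i c i) * form_eval s y.
Proof.
move=> xy; rewrite /form_eval big_distrr; apply: eq_bigr => e _ /=.
rewrite mulrCA -big_split; congr (_ * _); apply: eq_bigr => i _.
by rewrite xy mxE.
Qed.

(** At a tuple [x], the two composite pullbacks evaluate [s] at tuples whose [i]-th entries are
    proportional with ratio [c i]; multilinearity multiplies these ratios together. *)
Lemma pullback_comm (M N : 'I_4 -> GL2 K) (p q : 'S_4) (c : 'I_4 -> K) :
  (forall i, p (q i) = q (p i)) ->
  (forall i, val (N i) *m val (M (q i)) = c i *: (val (M i) *m val (N (p i)))) ->
  forall s, pullback M p (pullback N q s) =
    (\prod_i c i) *: pullback N q (pullback M p s).
Proof.
move=> pq MN s; rewrite !lfunE /=; apply/ffunP => e.
rewrite -[LHS]form_eval_delta ffunE -[X in _ *: X]form_eval_delta.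
rewrite !form_eval_pullback; apply: form_eval_scale => i.
by rewrite /lift_act !mulmxA MN pq -scalemxAl.
Qed.

(** [preserves] supplies only some lift. Any other lift changes the pullback by a nonzero scalar,
    which does not affect the image of a line. *)
Lemma preserves_lift (M : 'I_4 -> GL2 K) (p : 'S_4) (D : linsys K) :
  preserves (prod_aut (fun i => mobius (M i)) p) D ->
  (pullback M p @: val D)%VS = val D.
Proof.
case=> N [q [/pullback_lift [c c0 e] {2}<-]].
apply: subv_anti; apply/andP; split; apply/subvP.
  move=> _ /memv_imgP [s sD ->]; rewrite e -linearZ.
  by apply: memv_img; apply: memvZ.
move=> _ /memv_imgP [s sD ->].
by rewrite -[X in X \in _](scalerK c0) -e -linearZ memv_img // memvZ.
Qed.

Lemma line_eigen (f : 'End(H0 K)) (D : linsys K) :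
  (f @: val D)%VS = val D ->
  exists2 a, a != 0 & f (vpick (val D)) = a *: vpick (val D).
Proof.
have v0 : vpick (val D) != 0 by rewrite vpick0 -dimv_eq0 (eqP (valP D)).
have DE : val D = <[vpick (val D)]>%VS.
  apply/eqP; rewrite eq_sym eqEdim -memvE memv_pick dim_vline v0.
  by rewrite (eqP (valP D)).
move: (vpick _) v0 DE => v v0 ->; rewrite limg_line => e.
have /vlineP [a fa] : f v \in <[v]>%VS by rewrite -e memv_line.
exists a => //; apply/eqP => a0; move: (memv_line v).
by rewrite -e fa a0 scale0r => /vlineP [b]; rewrite scaler0 => /eqP; apply/negP.
Qed.

Lemma no_common_preserved (M N : 'I_4 -> GL2 K) (p q : 'S_4) (c : 'I_4 -> K)
    (D : linsys K) :
  (forall i, p (q i) = q (p i)) ->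
  (forall i, val (N i) *m val (M (q i)) = c i *: (val (M i) *m val (N (p i)))) ->
  \prod_i c i != 1 ->
  preserves (prod_aut (fun i => mobius (M i)) p) D ->
  preserves (prod_aut (fun i => mobius (N i)) q) D -> False.
Proof.
move=> pq MN c1 /preserves_lift/line_eigen [a a0 Ma].
move=> /preserves_lift/line_eigen [b b0 Nb].
have v0 : vpick (val D) != 0 by rewrite vpick0 -dimv_eq0 (eqP (valP D)).
have := pullback_comm pq MN (vpick (val D)).
rewrite Nb Ma !linearZ /= Nb Ma !scalerA => /eqP.
(* The eigenvector is nonzero, so its coefficients on the two sides agree; cancelling the nonzero
   product of [a] and [b] forces the product of the [c i] to be 1. *)
rewrite -subr_eq0 -scalerBl scaler_eq0 (negPf v0) orbF subr_eq0.
rewrite mulrAC mulrC -[X in X == _]mulr1 (inj_eq (mulfI (mulf_neq0 a0 b0))) eq_sym.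
exact/negP.
Qed.

End Mobius.

(** * The two explicit groups *)

Lemma cycle4_val :
  [/\ cycle4 i1 i3 i2 i4 i1 = i3, cycle4 i1 i3 i2 i4 i2 = i4,
      cycle4 i1 i3 i2 i4 i3 = i2 & cycle4 i1 i3 i2 i4 i4 = i1].
Proof. by split; rewrite /cycle4 !permM !permE. Qed.

Lemma tperm12_34_val (s := (tperm i1 i2 * tperm i3 i4)%g) :
  [/\ s i1 = i2, s i2 = i1, s i3 = i4 & s i4 = i3].
Proof. by split; rewrite !permM !permE. Qed.

Lemma tperm13_24_val (s := (tperm i1 i3 * tperm i2 i4)%g) :
  [/\ s i1 = i3, s i2 = i4, s i3 = i1 & s i4 = i2].
Proof. by split; rewrite !permM !permE. Qed.

Section Groups.
Variable K : numFieldType.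
Let A := mobA K.
Let B := mobB K.

Lemma klein_free_pt : exists y : P1 K, [/\ A y <> y, B y <> y & B (A y) <> y].
Proof.
(* The point (1:2) works: [A] fixes only (1:0) and (0:1), [B] only (1:1) and (1:-1), and [BA] only
   points with x0^2 + x1^2 = 0. The three determinants differ from zero because 4, 3 and 5 do in
   characteristic 0. *)
pose v : 'cV[K]_2 := \col_i (if i == 0 then 1 else 2%:R).
have v0 : v != 0.
  by apply/eqP => /matrixP/(_ 0 0); rewrite !mxE => /eqP; rewrite oner_eq0.
have BA_unit : val (gl2_B K) *m val (gl2_A K) \in unitmx.
  by rewrite unitmx_mul (valP (gl2_B K)) (valP (gl2_A K)).
pose BA : GL2 K := exist (fun M => M \in unitmx) _ BA_unit.
have BAE x : B (A x) = mobius BA x.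
  rewrite -[x in RHS]/(id x) -[id in RHS]mobius1.
  apply: (mobius_comp_eq (oner_neq0 _)).
  by rewrite mulmx1 scale1r.
have simp := (mul0r, mulr1, mul1r, addr0, add0r, mulN1r, mulNr).
exists (pt v0); split; rewrite ?BAE; apply: mobius_pt_neq;
  rewrite /= ?mx2_mul !mxE !big_ord_recl !big_ord0 !mxE /= !simp.
- by rewrite -subr_eq0 opprK -natrD pnatr_eq0.
- by rewrite -natrM pnatr_eq1.
- by rewrite eq_sym -subr_eq0 opprK -natrM addrC natr1 pnatr_eq0.
Qed.

Lemma G_iso :
  isomorphic_to ('Z_8 * 'Z_2)%type (gen_group
    [set prod_aut (quad id id id A) (cycle4 i1 i3 i2 i4);
         prod_aut (quad B B B B) 1%g]%classic).
Proof.
set g := prod_aut _ _; set b := prod_aut _ 1%g.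
have gE x1 x2 x3 x4 : g (qpt x1 x2 x3 x4) = qpt x3 x4 x2 (A x1).
  have [e1 e2 e3 e4] := cycle4_val.
  by apply: qptP; rewrite prod_autE ?(e1, e2, e3, e4) !ffunE.
have bE x1 x2 x3 x4 : b (qpt x1 x2 x3 x4) = qpt (B x1) (B x2) (B x3) (B x4).
  by apply: qptP; rewrite prod_autE perm1 !ffunE.
have AK : involutive A := @mobA_invol K.
have BK : involutive B := @mobB_invol K.
have AB x : A (B x) = B (A x) := mobAB x.
have [y [yA yB yAB]] := klein_free_pt.
(* The fourth iterate of [g] is [A] on every factor, so [g] has order 8. *)
apply: (@gen_group_isog_ZxZ _ _ _ 6 0 (qpt y y y y)).
- by move=> x; rewrite [x]qpt_eta /= !gE !AK.
- by move=> x; rewrite [x]qpt_eta /= !bE !BK.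
- by move=> x; rewrite [x]qpt_eta gE !bE gE AB.
move=> i j.
(* Finite check of all exponents: apart from (0, 0), some coordinate of the image of (y,y,y,y) is
   [A y], [B y] or [B (A y)], hence not [y]. *)
by do 8?[case: i => [|i] //]; do 2?[case: j => [|j] //];
  move=> _ _; rewrite /= ?bE ?gE ?AB ?AK => /qpt_inj[].
Qed.

Lemma H_iso :
  isomorphic_to ('Z_4 * 'Z_4)%type (gen_group
    [set prod_aut (quad id A id A) (tperm i1 i2 * tperm i3 i4)%g;
         prod_aut (quad id id B B) (tperm i1 i3 * tperm i2 i4)%g]%classic).
Proof.
set g := prod_aut (quad _ A _ _) _; set b := prod_aut _ (tperm i1 i3 * _)%g.
have gE x1 x2 x3 x4 : g (qpt x1 x2 x3 x4) = qpt x2 (A x1) x4 (A x3).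
  have [e1 e2 e3 e4] := tperm12_34_val.
  by apply: qptP; rewrite prod_autE ?(e1, e2, e3, e4) !ffunE.
have bE x1 x2 x3 x4 : b (qpt x1 x2 x3 x4) = qpt x3 x4 (B x1) (B x2).
  have [e1 e2 e3 e4] := tperm13_24_val.
  by apply: qptP; rewrite prod_autE ?(e1, e2, e3, e4) !ffunE.
have AK : involutive A := @mobA_invol K.
have BK : involutive B := @mobB_invol K.
have AB x : A (B x) = B (A x) := mobAB x.
have [y [yA yB yAB]] := klein_free_pt.
(* The squares of [g] and [b] are [A] and [B] on every factor, so both have order 4. *)
apply: (@gen_group_isog_ZxZ _ _ _ 2 2 (qpt y y y y)).
- by move=> x; rewrite [x]qpt_eta /= !gE !AK.
- by move=> x; rewrite [x]qpt_eta /= !bE !BK.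
- by move=> x; rewrite [x]qpt_eta gE !bE gE !AB.
move=> i j.
by do 4?[case: i => [|i] //]; do 4?[case: j => [|j] //];
  move=> _ _; rewrite /= ?bE ?gE ?AB ?AK => /qpt_inj[].
Qed.

Lemma quad_mobius (M1 M2 M3 M4 : GL2 K) :
  quad (mobius M1) (mobius M2) (mobius M3) (mobius M4) =
  fun i => mobius (quad M1 M2 M3 M4 i).
Proof. by apply: funext; apply: ord4P. Qed.

Lemma prod_quadN1 :
  \prod_i quad 1 1 1 (- 1 : K) i != 1.
Proof.
rewrite !big_ord_recl big_ord0 /quad !(tnth_nth 0) /= !mul1r mulr1.
by rewrite eq_sym -subr_eq0 opprK -mulr2n pnatr_eq0.
Qed.

Lemma G_no_invariant (D : linsys K) :
  ~ invariant_div (gen_group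
    [set prod_aut (quad id id id A) (cycle4 i1 i3 i2 i4);
         prod_aut (quad B B B B) 1%g]%classic) D.
Proof.
move=> inv.
have := inv _ (gen_in (or_introl erefl)); have := inv _ (gen_in (or_intror erefl)).
(* Writing the identity as the map of the identity matrix gives each generator an explicit matrix
   lift. *)
rewrite -(mobius1 K) !quad_mobius => pb pg.
have [e1 e2 e3 e4] := cycle4_val.
(* Only the fourth factor of the second generator's partner carries [A], so it alone compares [AB]
   with [BA] and contributes -1. *)
apply: (no_common_preserved _ _ prod_quadN1 pb pg); apply: ord4P;
  rewrite !perm1 ?(e1, e2, e3, e4) // /quad !(tnth_nth (gl2_1 K)) (tnth_nth 0);
  by rewrite /= ?scale1r ?mulmx1 ?mul1mx ?gl2_AB.
Qed.

Lemma H_no_invariant (D : linsys K) :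
  ~ invariant_div (gen_group
    [set prod_aut (quad id A id A) (tperm i1 i2 * tperm i3 i4)%g;
         prod_aut (quad id id B B) (tperm i1 i3 * tperm i2 i4)%g]%classic) D.
Proof.
move=> inv.
have := inv _ (gen_in (or_introl erefl)); have := inv _ (gen_in (or_intror erefl)).
rewrite -(mobius1 K) !quad_mobius => pb pg.
have [e1 e2 e3 e4] := tperm12_34_val; have [f1 f2 f3 f4] := tperm13_24_val.
have perms := (e1, e2, e3, e4, f1, f2, f3, f4).
(* The first three factors give 1, [A] and [B] in either order; the fourth gives [AB] against [BA],
   hence the ratio -1. *)
apply: (no_common_preserved _ _ prod_quadN1 pb pg); apply: ord4P;
  rewrite !perms // /quad !(tnth_nth (gl2_1 K)) (tnth_nth 0);
  by rewrite /= ?scale1r ?mulmx1 ?mul1mx ?gl2_AB.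
Qed.

End Groups.

Theorem proposition5p1 (R : realType) :
  let A := mobA R[i] in
  let B := mobB R[i] in
  let G := gen_group
    [set prod_aut (quad id id id A) (cycle4 i1 i3 i2 i4);
         prod_aut (quad B B B B) 1%g]%classic in
  let H := gen_group
    [set prod_aut (quad id A id A) (tperm i1 i2 * tperm i3 i4)%g;
         prod_aut (quad id id B B) (tperm i1 i3 * tperm i2 i4)%g]%classic in
  (isomorphic_to ('Z_8 * 'Z_2)%type G
     /\ ~ exists D : linsys R[i], invariant_div G D)
  /\ (isomorphic_to ('Z_4 * 'Z_4)%type H
     /\ ~ exists D : linsys R[i], invariant_div H D).
Proof.
split; split.
- exact: G_iso.
- by case=> D; apply: G_no_invariant.
- exact: H_iso.
- by case=> D; apply: H_no_invariant.
Qed.
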